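(* $[\mathcal{F}] := \{[A] : A \in \mathcal{F}\}$ is a monotone class in $\mathcal{P}(\mathbb{N}) / \mathcal{N}$ on which $\nu$ is countably additive.
   Context: $\mathbb{N} = \{1,2,3,\ldots\}$. $\mathcal{F}$ is the collection of all $A \subseteq \mathbb{N}$ for which the limit $\nu(A) := \lim_{N\to\infty} \frac{1}{N}\sum_{n=1}^N I_A(n)$ exists ($I_A$ the indicator function), and $\mathcal{N} := \{A \in \mathcal{F} : \nu(A) = 0\}$, which is an ideal of the Boolean algebra $\mathcal{P}(\mathbb{N})$. $[A]$ is the equivalence class of $A$ in the Boolean quotient $\mathcal{P}(\mathbb{N})/\mathcal{N}$, i.e. under $A \sim B \iff A \triangle B \in \mathcal{N}$; the order is $[A] \leq [B] \iff A \setminus B \in \mathcal{N}$. $\nu$ is defined on $[\mathcal{F}]$ by $\nu[A] := \nu(A)$ for $A \in \mathcal{F}$ (well defined). A subset $\mathcal{M}$ of a Boolean algebra $\mathcal{A}$ is a monotone class (in $\mathcal{A}$) if every non-decreasing sequence $p_1 \leq p_2 \leq \ldots$ in $\mathcal{M}$ has an upper bound belonging to $\mathcal{M}$ that is less than or equal to every upper bound of the sequence in $\mathcal{A}$ (not merely in $\mathcal{M}$), and every non-increasing sequence in $\mathcal{M}$ has a lower bound belonging to $\mathcal{M}$ that is greater than or equal to every lower bound of the sequence in $\mathcal{A}$. Countable additivity of $\nu$ on $[\mathcal{F}]$ means: for every sequence $\{[A_k]\}_{k=1}^\infty$ in $[\mathcal{F}]$ that is pairwise disjoint ($A_j \cap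 A_k \in \mathcal{N}$ for $j \neq k$), the supremum $\bigvee_{k=1}^\infty [A_k]$ in $\mathcal{P}(\mathbb{N})/\mathcal{N}$ exists and belongs to $[\mathcal{F}]$, and $\nu(\bigvee_{k=1}^\infty [A_k]) = \sum_{k=1}^\infty \nu[A_k]$. *)

(* Defs.v *)
From HB Require Import structures.
From mathcomp Require Import all_boot all_order all_algebra.
From mathcomp Require Import generic_quotient.
From mathcomp Require Import all_classical all_reals all_analysis.

Set Implicit Arguments.
Unset Strict Implicit.
Unset Printing Implicit Defensive.

Import Order.TTheory GRing.Theory Num.Theory.
Import numFieldNormedType.Exports.

Local Open Scope classical_set_scope.
Local Open Scope ring_scope.
Local Open Scope quotient_scope.

(* The positive integers {1, 2, 3, ...}. *)
Definition posnat := {n : nat | (0 < n)%N}.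

Section density.
Variable R : realType.
Implicit Types A B C : set posnat.

(* val @` A is A viewed as a set of elements of nat.  The value at N = 0 is
   the junk value 0; it does not affect the limit. *)
Definition freq A (N : nat) : R :=
  N%:R^-1 * \sum_(1 <= n < N.+1) \1_(val @` A) n.

(* The collection F, the density nu on sets, and the ideal N. *)
Definition densF : set (set posnat) := [set A | cvgn (freq A)].

Definition dens A : R := limn (freq A).

Definition densN : set (set posnat) := [set A | densF A /\ dens A = 0].

Lemma freq_ge0 A N : 0 <= freq A N.
Proof. by rewrite mulr_ge0 ?invr_ge0// sumr_ge0. Qed.

Lemma le_freq A B N : A `<=` B -> freq A N <= freq B N.
Proof.
move=> AB; rewrite ler_wpM2l ?invr_ge0// ler_sum// => n _.
rewrite !indicE ler_nat; case: (boolP (n \in _)) => //=.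
by rewrite inE => -[x Ax <-]; rewrite mem_set//; exists x => //; exact: AB.
Qed.

Lemma freqU A B N : freq (A `|` B) N <= freq A N + freq B N.
Proof.
rewrite -mulrDr ler_wpM2l ?invr_ge0// -big_split ler_sum//= => n _.
rewrite image_setU !indicE in_setU -natrD ler_nat.
by case: (n \in _); case: (n \in _).
Qed.

Lemma densNP A : densN A <-> freq A @ \oo --> (0 : R).
Proof.
split=> [[cA /= <-]//|cA]; split; first by apply/cvg_ex; exists 0.
exact/cvg_lim.
Qed.

Lemma freq_squeeze0 A (u : nat -> R) :
  (forall n, freq A n <= u n) -> u @ \oo --> (0 : R) -> freq A @ \oo --> (0 : R).
Proof.
move=> Au u0; apply: (@squeeze_cvgr _ _ _ _ (fun=> 0) u) => //.
  by near=> n; rewrite freq_ge0 Au.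
exact: cvg_cst.
Unshelve. all: by end_near. Qed.

Lemma densN_sub A B : A `<=` B -> densN B -> densN A.
Proof.
move=> AB /densNP cB; apply/densNP.
apply: (freq_squeeze0 _ cB) => n; exact: le_freq.
Qed.

Lemma densNU A B : densN A -> densN B -> densN (A `|` B).
Proof.
move=> /densNP cA /densNP cB; apply/densNP.
have cAB : (fun n => freq A n + freq B n) @ \oo --> (0 : R).
  by rewrite -[0]addr0; exact: cvgD.
apply: (freq_squeeze0 _ cAB) => n; exact: freqU.
Qed.

Lemma densN0 : densN set0.
Proof.
apply/densNP; rewrite (_ : freq set0 = fun=> 0); first exact: cvg_cst.
by apply/funext => N; rewrite /freq image_set0 big1 ?mulr0// => i _; rewrite indic0.
Qed.

Definition dens_sim : rel (set posnat) := fun A B => `[< densN (A `+` B) >].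

Lemma dens_sim_refl : reflexive dens_sim.
Proof. by move=> A; apply/asboolP; rewrite setYK; exact: densN0. Qed.

Lemma dens_sim_sym : symmetric dens_sim.
Proof. by move=> A B; rewrite /dens_sim setYC. Qed.

Lemma dens_sim_trans : transitive dens_sim.
Proof.
move=> B A C /asboolP AB /asboolP BC; apply/asboolP.
apply: densN_sub (densNU AB BC) => x.
rewrite /setY /setU /setD /setI /=.
by case: (pselect (B x)) => ?; tauto.
Qed.

Definition dens_equiv := EquivRel dens_sim dens_sim_refl dens_sim_sym dens_sim_trans.

(* The quotient P(N)/N; cls A is the class [A]. *)
Definition PN := {eq_quot dens_equiv}.
HB.instance Definition _ := Choice.on PN.
HB.instance Definition _ := EqQuotient.on PN.

Definition cls A : PN := \pi_PN A.

Lemma cls_eqP A B : cls A = cls B <-> densN (A `+` B).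
Proof.
split=> [/eqP|AB]; first by rewrite /cls piE => /asboolP.
by apply/eqP; rewrite /cls piE; apply/asboolP.
Qed.

Lemma repr_cls A : densN (repr (cls A) `+` A).
Proof. by apply/cls_eqP; rewrite /cls reprK. Qed.

Lemma clsP (x : PN) : exists A, x = cls A.
Proof. by exists (repr x); rewrite /cls reprK. Qed.

Definition PN_le (x y : PN) : bool := `[< densN (repr x `\` repr y) >].
Definition PN_lt (x y : PN) : bool := (y != x) && PN_le x y.
Definition PN_meet (x y : PN) : PN := cls (repr x `&` repr y).
Definition PN_join (x y : PN) : PN := cls (repr x `|` repr y).
Definition PN_compl (x : PN) : PN := cls (~` repr x).

Lemma PN_le_cls A B : PN_le (cls A) (cls B) <-> densN (A `\` B).
Proof.
have hA := repr_cls A; have hB := repr_cls B.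
split=> [/asboolP h|h]; last apply/asboolP.
- apply: densN_sub (densNU (densNU hA hB) h) => x [Ax Bx].
  have [rA|rA] := pselect (repr (cls A) x); last by left; left; right.
  by have [rB|rB] := pselect (repr (cls B) x); [left; right; left|right].
- apply: densN_sub (densNU (densNU hA hB) h) => x [Ax Bx].
  have [rA|rA] := pselect (A x); last by left; left; left.
  by have [rB|rB] := pselect (B x); [left; right; right|right].
Qed.

Lemma PN_meet_cls A B : PN_meet (cls A) (cls B) = cls (A `&` B).
Proof.
apply/cls_eqP; apply: densN_sub (densNU (repr_cls A) (repr_cls B)) => x.
rewrite /setY /setU /setD /setI /=.
by case: (pselect (A x)); case: (pselect (B x)); case: (pselect (repr (cls A) x));
   case: (pselect (repr (cls B) x)); tauto.
Qed.

Lemma PN_join_cls A B : PN_join (cls A) (cls B) = cls (A `|` B).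
Proof.
apply/cls_eqP; apply: densN_sub (densNU (repr_cls A) (repr_cls B)) => x.
rewrite /setY /setU /setD /setI /=.
by case: (pselect (A x)); case: (pselect (B x)); case: (pselect (repr (cls A) x));
   case: (pselect (repr (cls B) x)); tauto.
Qed.

Lemma PN_compl_cls A : PN_compl (cls A) = cls (~` A).
Proof.
apply/cls_eqP; apply: densN_sub (repr_cls A) => x.
rewrite /setY /setU /setD /setC /=.
by case: (pselect (A x)) => ?; case: (pselect (repr (cls A) x)) => ?; tauto.
Qed.

Fact PN_le_def x y : PN_le x y = (PN_meet x y == x).
Proof.
have [A ->] := clsP x; have [B ->] := clsP y; rewrite PN_meet_cls.
apply/idP/eqP => [/PN_le_cls h|/cls_eqP h]; [apply/cls_eqP|apply/PN_le_cls].
- by apply: densN_sub h => z [[[]//]|[Az AB]]; split=> // Bz; apply: AB.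
- by apply: densN_sub h => z [Az Bz]; right; split=> // -[].
Qed.

Fact PN_meetC : commutative PN_meet.
Proof. by move=> x y; rewrite /PN_meet setIC. Qed.

Fact PN_joinC : commutative PN_join.
Proof. by move=> x y; rewrite /PN_join setUC. Qed.

Fact PN_meetA : associative PN_meet.
Proof.
move=> x y z; have [A ->] := clsP x; have [B ->] := clsP y.
by have [C ->] := clsP z; rewrite !PN_meet_cls setIA.
Qed.

Fact PN_joinA : associative PN_join.
Proof.
move=> x y z; have [A ->] := clsP x; have [B ->] := clsP y.
by have [C ->] := clsP z; rewrite !PN_join_cls setUA.
Qed.

Fact PN_joinKI y x : PN_meet x (PN_join x y) = x.
Proof.
have [A ->] := clsP x; have [B ->] := clsP y.
by rewrite PN_join_cls PN_meet_cls setUC setKU.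
Qed.

Fact PN_meetKU y x : PN_join x (PN_meet x y) = x.
Proof.
have [A ->] := clsP x; have [B ->] := clsP y.
by rewrite PN_meet_cls PN_join_cls setIC setKI.
Qed.

Fact PN_meetUl : left_distributive PN_meet PN_join.
Proof.
move=> x y z; have [A ->] := clsP x; have [B ->] := clsP y.
by have [C ->] := clsP z; rewrite !(PN_meet_cls, PN_join_cls) setIUl.
Qed.

Fact PN_meetxx : idempotent_op PN_meet.
Proof. by move=> x; have [A ->] := clsP x; rewrite PN_meet_cls setIid. Qed.

Fact PN_display : Order.disp_t. Proof. by []. Qed.

HB.instance Definition _ := @Order.isMeetJoinDistrLattice.Build PN_display PN
  PN_le PN_lt PN_meet PN_join PN_le_def (fun _ _ => erefl)
  PN_meetC PN_joinC PN_meetA PN_joinA PN_joinKI PN_meetKU PN_meetUl PN_meetxx.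

Fact PN_le0x (x : PN) : (cls set0 <= x)%O.
Proof.
by have [A ->] := clsP x; apply/PN_le_cls; rewrite set0D; exact: densN0.
Qed.

Fact PN_lex1 (x : PN) : (x <= cls setT)%O.
Proof.
by have [A ->] := clsP x; apply/PN_le_cls; rewrite setDT; exact: densN0.
Qed.

HB.instance Definition _ := Order.hasBottom.Build PN_display PN PN_le0x.
HB.instance Definition _ := Order.hasTop.Build PN_display PN PN_lex1.

Fact PN_joinxC (x : PN) : (x `|` PN_compl x = \top)%O.
Proof.
have [A ->] := clsP x; rewrite PN_compl_cls.
by rewrite [LHS]PN_join_cls setUCr.
Qed.

Fact PN_meetxC (x : PN) : (x `&` PN_compl x = \bot)%O.
Proof.
have [A ->] := clsP x; rewrite PN_compl_cls.
by rewrite [LHS]PN_meet_cls setICr.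
Qed.

HB.instance Definition _ := Order.TBDistrLattice_hasComplement.Build
  PN_display PN PN_joinxC PN_meetxC.

Lemma le_cls A B : (cls A <= cls B)%O <-> densN (A `\` B).
Proof. exact: PN_le_cls. Qed.

Lemma meet_cls A B : (cls A `&` cls B)%O = cls (A `&` B).
Proof. exact: PN_meet_cls. Qed.

Lemma join_cls A B : (cls A `|` cls B)%O = cls (A `|` B).
Proof. exact: PN_join_cls. Qed.

Lemma compl_cls A : (~` cls A)%O = cls (~` A).
Proof. exact: PN_compl_cls. Qed.

Lemma disjoint_cls A B : (cls A `&` cls B = \bot)%O <-> densN (A `&` B).
Proof. by rewrite meet_cls -[(A `&` B) in X in _ <-> X]setY0; exact: cls_eqP. Qed.

(* [F] *)
Definition PNF : set PN := [set cls A | A in densF].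

(* Meaningful on PNF only, where it is independent of the representative: see
   nu_cls. *)
Definition nu (x : PN) : R := dens (repr x).

Lemma freq_diff A B N : `|freq A N - freq B N| <= freq (A `+` B) N.
Proof.
rewrite ler_distl lerBlDr; apply/andP; split.
- apply: le_trans (freqU _ _ _); apply: le_freq => x Bx.
  by have [Ax|Ax] := pselect (A x); [left|right; right].
- apply: le_trans (freqU _ _ _); apply: le_freq => x Ax.
  by have [Bx|Bx] := pselect (B x); [left|right; left].
Qed.

Lemma densN_cvg A B (l : R) : densN (A `+` B) -> freq A @ \oo --> l -> freq B @ \oo --> l.
Proof.
move=> /densNP cAB cA.
have dAB : (fun n => freq A n - freq B n) @ \oo --> (0 : R).
  apply/norm_cvg0P.
  apply: (@squeeze_cvgr _ _ _ _ (fun=> 0) (freq (A `+` B))) => //.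
    by near=> n; rewrite normr_ge0/= freq_diff.
  exact: cvg_cst.
rewrite (_ : freq B = fun n => freq A n - (freq A n - freq B n)).
  by rewrite -[l]subr0; exact: cvgB.
by apply/funext => n; rewrite opprB addrC subrK.
Unshelve. all: by end_near. Qed.

Lemma PNF_cls A : PNF (cls A) <-> densF A.
Proof.
split=> [[B /cvg_ex[l cB] /cls_eqP BA]|]; last by exists A.
by apply/cvg_ex; exists l; exact: densN_cvg BA cB.
Qed.

Lemma nu_cls A : densF A -> nu (cls A) = dens A.
Proof.
move=> cA; apply/cvg_lim => //; apply: densN_cvg cA.
by rewrite setYC; exact: repr_cls.
Qed.

Definition nu_countably_additive :=
  forall A : nat -> set posnat,
    (forall k, PNF (cls (A k))) ->
    (forall j k, j <> k -> densN (A j `&` A k)) ->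
    exists s : PN, [/\ supremums (range (fun k => cls (A k))) s,
      PNF s &
      series (fun k => nu (cls (A k))) @ \oo --> nu s].

End density.
Arguments PNF R : clear implicits.

(* supremums and infimums are least upper and greatest lower bounds in the
   whole Boolean algebra T, not relative to M. *)
Definition boolean_monotone_class d (T : ctbDistrLatticeType d) (M : set T) :=
  (forall p : nat -> T, nondecreasing_seq p -> (forall k, M (p k)) ->
     exists2 s, M s & supremums (range p) s) /\
  (forall p : nat -> T, nonincreasing_seq p -> (forall k, M (p k)) ->
     exists2 i, M i & infimums (range p) i).

(* Main.v *)
Require Import Defs.
From mathcomp Require Import all_boot all_order all_algebra.
From mathcomp Require Import all_classical all_reals all_analysis.
From mathcomp Require Import zify lra.

Set Implicit Arguments.
Unset Strict Implicit.
Unset Printing Implicit Defensive.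

Import Order.TTheory Order.CTheory GRing.Theory Num.Theory.
Import numFieldNormedType.Exports.

Local Open Scope classical_set_scope.
Local Open Scope ring_scope.

(** The heart of the matter is a diagonal construction.  Let [A k] be an
increasing sequence of sets with densities [l k], increasing to [L].  The plain
union may be far too large, but it can be thinned out: an element [x] is kept
only when it belongs to some [A k] with [k <= x] whose frequencies stay, from
[x] on, at most [L + 1/(k+1)].  The resulting set [S] loses only finitely many elements of each
[A k], so that its lower density is at least every [l k], hence at least [L].
On the other hand [S] is contained, up to [N], in a single [A K], where
[K] tends to infinity with [N] and [A K] is under control at [N], so that its
upper density is at most [L] ([diagonal_limit]).

Such an [S] is automatically a least upper bound modulo null sets: if [U]
contains every [A k] up to a null set, then [S `\` U] is contained in
[(S `\` A k) `|` (A k `\` U)], whose upper density is at most [L - l k], for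
every [k] ([densN_setD_limit]).

For an arbitrary sequence of classes both facts are used on the partial unions
of representatives ([supremum_of_partial_unions]); it is enough that each finite
partial union has a density.  For a nondecreasing sequence in [F] this holds as
the partial unions represent the terms themselves; for an almost disjoint
sequence it holds by finite additivity, the densities being then the partial
sums of the series.  Nonincreasing sequences are handled by complementation. *)

(** * Frequencies *)

Lemma indic_val (R : realType) (A : set posnat) (x : posnat) :
  \1_(val @` A) (val x) = \1_A x :> R.
Proof.
rewrite !indicE; congr (_ %:R); congr nat_of_bool.
apply/idP/idP; rewrite !inE; first by move=> [y Ay] /val_inj <-.
by move=> Ax; exists x.
Qed.

(** [freq A N] depends only on the elements of [A] up to [N]; the diagonal
construction compares two sets on an initial segment only. *)
Lemma le_freq_initial (R : realType) (A B : set posnat) (N : nat) :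
  (forall x, (val x <= N)%N -> A x -> B x) -> freq R A N <= freq R B N.
Proof.
move=> AB; rewrite ler_wpM2l ?invr_ge0// !big_nat ler_sum// => n /andP[n0 nN].
have -> : n = val (Sub n n0 : posnat) by rewrite SubK.
rewrite !indic_val !indicE ler_nat; case: (boolP (_ \in A)) => //=.
by rewrite inE => Ax; rewrite mem_set//; apply: AB => //; rewrite SubK.
Qed.

Lemma freqU_disjoint (R : realType) (A B : set posnat) (N : nat) :
  A `&` B = set0 -> freq R (A `|` B) N = freq R A N + freq R B N.
Proof.
move=> AB0; rewrite -mulrDr -big_split; congr (_ * _).
rewrite !big_nat; apply: eq_bigr => n /andP[n0 nN] /=.
have -> : n = val (Sub n n0 : posnat) by rewrite SubK.
rewrite !indic_val !indicE in_setU -natrD.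
set x := Sub _ _; have : x \in A `&` B = false by rewrite AB0 in_set0.
by rewrite in_setI; case: (x \in A); case: (x \in B).
Qed.

Lemma freq_setDI (R : realType) (A B : set posnat) (N : nat) :
  freq R (A `\` B) N = freq R A N - freq R (A `&` B) N.
Proof.
apply/eqP; rewrite eq_sym subr_eq -freqU_disjoint; first by rewrite setUC setUIDK.
by rewrite -subset0 => x [[] ? ? []].
Qed.

(** Cancelling the common part [A `&` B] trades [A `\` B] for [B `\` A]; this
is what lets a null set [B `\` A] be ignored in the sequel. *)
Lemma freq_setD (R : realType) (A B : set posnat) (N : nat) :
  freq R (A `\` B) N = freq R A N - freq R B N + freq R (B `\` A) N.
Proof. by rewrite !freq_setDI (setIC B A); lra. Qed.

Lemma freq_setT (R : realType) (N : nat) : freq R setT N = (0 < N)%N%:R.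
Proof.
rewrite /freq big_nat (eq_bigr (fun=> 1)); last first.
  move=> n /andP[n0 nN]; have -> : n = val (Sub n n0 : posnat) by rewrite SubK.
  by rewrite indic_val indicT.
rewrite -big_nat sumr_const_nat subSS subn0; case: N => [|N]; first by rewrite mulr0n mulr0.
by rewrite mulVf// pnatr_eq0.
Qed.

Lemma cvg_freq_setC (R : realType) (A : set posnat) (l : R) :
  freq R A @ \oo --> l -> freq R (~` A) @ \oo --> 1 - l.
Proof.
move=> cA.
have cT : freq R setT @ \oo --> (1 : R).
  apply: cvg_near_cst; near=> n; rewrite freq_setT.
  by have -> : (0 < n)%N by near: n; exact: nbhs_infty_gt.
suff -> : freq R (~` A) = freq R setT \- freq R A by exact: cvgB.
by apply/funext => N; rewrite -setTD freq_setDI setTI.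
Unshelve. all: by end_near. Qed.

(** The initial segment of length [M] contributes at most [M] to the counting
sum, hence at most [M / N] to the frequency. *)
Lemma densN_bounded (R : realType) (A : set posnat) (M : nat) :
  (forall x, A x -> (val x < M)%N) -> densN R A.
Proof.
move=> AM; apply/densNP/(@freq_squeeze0 _ _ (fun n => n%:R^-1 * M%:R)); last first.
  rewrite -[0 in X in _ --> X](mul0r M%:R); apply: cvgMl.
  by rewrite -cvg_shiftS; exact: cvg_harmonic.
move=> N; rewrite ler_wpM2l ?invr_ge0//.
have sumM : (\sum_(1 <= n < N.+1) (n < M) <= minn N M)%N.
  elim: N => [|N IH]; first by rewrite big_geq.
  by rewrite big_nat_recr//=; move: IH; case: ltnP; lia.
apply: (@le_trans _ _ (\sum_(1 <= n < N.+1) (n < M)%N)%:R); last first.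
  by rewrite ler_nat; apply: leq_trans sumM _; exact: geq_minr.
rewrite natr_sum !big_nat ler_sum// => n /andP[n0 _].
have -> : n = val (Sub n n0 : posnat) by rewrite SubK.
rewrite indic_val indicE ler_nat; case: (boolP (_ \in A)) => //=.
by rewrite inE => /AM; rewrite SubK => ->.
Qed.

(** * Suprema of increasing sequences *)

(** The set [S] is the thinned union described at the top.  The clause
[k <= val x] bounds the indices [k] that can account for the elements of [S]
below a given [N], so that there is a largest one among them. *)
Lemma diagonal_limit (R : realType) (A : nat -> set posnat) (l : nat -> R) (L : R) :
  {homo A : i j / (i <= j)%N >-> i `<=` j} ->
  (forall k, freq R (A k) @ \oo --> l k) ->
  (forall k, l k <= L) -> l @ \oo --> L ->
  exists2 S, freq R S @ \oo --> L & forall k, densN R (A k `\` S).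
Proof.
move=> Amono cA lL cl.
pose good k n := forall m, (n <= m)%N -> freq R (A k) m <= L + k.+1%:R^-1.
have good_near k : \forall n \near \oo, good k n.
  have : \forall m \near \oo, freq R (A k) m <= L + k.+1%:R^-1.
    by apply: (cvgr_le (l k) (cA k)); rewrite (le_lt_trans (lL k))// ltrDl invr_gt0.
  move=> [N _ AN]; exists N => // n /= Nn m nm; apply: AN => /=; exact: leq_trans nm.
pose S := [set x : posnat | exists k, [/\ (k <= val x)%N, good k (val x) & A k x]].
have AS k : densN R (A k `\` S).
  have [M _ gM] := good_near k.
  apply: (@densN_bounded _ _ (maxn k M)) => x [Ax nSx]; rewrite ltnNge; apply/negP.
  rewrite geq_max => /andP[kx Mx]; apply: nSx; exists k; split => //; exact: gM.
(* The largest index K that is good at N works for all of S below N: if k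
accounts for some x <= N then k is good at N too, so k <= K and A k `<=` A K. *)
have freqS k0 N : (k0 <= N)%N -> good k0 N -> freq R S N <= L + k0.+1%:R^-1.
  move=> k0N gk0.
  have exg : exists k, (k <= N)%N && `[< good k N >].
    by exists k0; rewrite k0N; apply/asboolP.
  have ubg k : (k <= N)%N && `[< good k N >] -> (k <= N)%N by case/andP.
  have [K /andP[KN /asboolP gK] Kmax] := ex_maxnP exg ubg.
  apply: (@le_trans _ _ (freq R (A K) N)).
    apply: le_freq_initial => x xN [k [kx gk Akx]]; apply: (Amono k) => //.
    apply: Kmax; rewrite (leq_trans kx)//; apply/asboolP => m Nm.
    by apply: gk; exact: leq_trans Nm.
  apply: le_trans (gK _ (leqnn _)) _; rewrite lerD2l lef_pV2 ?posrE// ler_nat ltnS.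
  by apply: Kmax; rewrite k0N; apply/asboolP.
exists S => //; apply/cvgrPdist_le => e e0.
have [k [/ltW ke lk]] : exists k, k.+1%:R^-1 < e /\ L - e / 2 < l k.
  have : \forall k \near \oo, k.+1%:R^-1 < e /\ L - e / 2 < l k.
    near=> k; split.
      by near: k; exact: (near_infty_natSinv_lt (PosNum e0)).
    by near: k; apply: (cvgr_gt L cl); rewrite ltrBlDr ltrDl divr_gt0.
  by case=> k _ /(_ k (leqnn k)); exists k.
(* Since A k is contained in S up to the null set A k `\` S, this difference is
a lower bound for freq S. *)
have cAS : (freq R (A k) \- freq R (A k `\` S)) @ \oo --> l k.
  by rewrite -[l k]subr0; apply: cvgB => //; apply/densNP.
near=> N; rewrite ler_distlC; apply/andP; split; last first.
  apply: le_trans (freqS k N _ _) _; last by rewrite lerD2l.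
    by near: N; exact: nbhs_infty_ge.
  by near: N; exact: good_near.
apply: (@le_trans _ _ ((freq R (A k) \- freq R (A k `\` S)) N)).
  near: N; apply: (cvgr_ge (l k) cAS); apply: le_lt_trans lk.
  by lra.
by rewrite /= freq_setD opprD opprB addrA addrCA subrr addr0 lerBlDr lerDl freq_ge0.
Unshelve. all: by end_near. Qed.

(** A density-theoretic criterion for least upper bounds: [S `\` A k] has density
[L - l k], which is as small as desired, so nothing of positive upper density in
[S] can escape an almost-upper bound [U]. *)
Lemma densN_setD_limit (R : realType) (A : nat -> set posnat) (l : nat -> R) (L : R)
    (S U : set posnat) :
  (forall k, freq R (A k) @ \oo --> l k) -> l @ \oo --> L -> freq R S @ \oo --> L ->
  (forall k, densN R (A k `\` S)) -> (forall k, densN R (A k `\` U)) ->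
  densN R (S `\` U).
Proof.
move=> cA cl cS AS AU; apply/densNP/cvgrPdist_le => e e0.
have [k lk] : exists k, L - e < l k.
  have : \forall k \near \oo, L - e < l k.
    by apply: (cvgr_gt L cl); rewrite ltrBlDr ltrDl.
  by case=> k _ /(_ k (leqnn k)); exists k.
pose g N := freq R S N - freq R (A k) N + freq R (A k `\` S) N + freq R (A k `\` U) N.
have cg : g @ \oo --> L - l k + 0 + 0.
  apply: cvgD; last exact/densNP.
  apply: cvgD; last exact/densNP.
  exact: cvgB.
rewrite !addr0 in cg.
near=> N; rewrite sub0r normrN ger0_norm ?freq_ge0//.
apply: (@le_trans _ _ (g N)); last first.
  by near: N; apply: (cvgr_le _ cg); rewrite ltrBlDr addrC -ltrBlDr.
rewrite /g -freq_setD; apply: le_trans (freqU _ _ _ _); apply: le_freq => x [Sx Ux].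
by have [Ax|Ax] := pselect (A k x); [right|left].
Unshelve. all: by end_near. Qed.

(** The common source of both halves of the theorem.  Passing to the partial
unions makes the sequence genuinely increasing, not just modulo null sets, and
leaves the upper bounds of the classes unchanged. *)
Lemma supremum_of_partial_unions (R : realType) (A : nat -> set posnat) (l : nat -> R) :
  (forall n, freq R (\big[setU/set0]_(k < n) A k) @ \oo --> l n) ->
  exists S (L : R), [/\ l @ \oo --> L, freq R S @ \oo --> L &
    supremums (range (fun k => cls R (A k))) (cls R S)].
Proof.
set B := fun n => \big[setU/set0]_(k < n) A k; move=> cB.
have Bmono : {homo B : i j / (i <= j)%N >-> i `<=` j} by exact: subset_bigsetU.
have lmono : nondecreasing_seq l.
  move=> i j ij; apply: (ler_cvg_to (cB i) (cB j)).
  by near=> N; apply: le_freq; exact: Bmono.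
have cl : cvgn l.
  apply: nondecreasing_is_cvgn => //; exists 1 => _ [k _ <-].
  apply: (cvgr_to_le (cB k)); near=> N.
  by apply: (le_trans (le_freq _ _ (@subsetT _ _))); rewrite freq_setT lern1 leq_b1.
have [S cS BS] := diagonal_limit Bmono cB (nondecreasing_cvgn_le lmono cl) cl.
exists S, (limn l); split => //; split => [_ [k _ <-]|y yub].
  apply/le_cls; apply: densN_sub (BS k.+1) => x [Ax Sx]; split => //.
  exact: (bigsetU_sup (ltnSn k)).
have [U yU] := clsP y; rewrite yU; apply/le_cls.
apply: (densN_setD_limit cB cl cS BS) => n; apply/le_cls; rewrite -yU.
elim: n => [|n IH]; first by rewrite /B big_ord0 le0x.
rewrite /B big_ord_recr/= -join_cls leUx IH/=; apply: yub.
by exists n.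
Unshelve. all: by end_near. Qed.

(** * Monotone class *)

Lemma densFP (R : realType) (A : set posnat) :
  densF R A <-> freq R A @ \oo --> dens R A.
Proof. by split=> // cA; apply/cvg_ex; exists (dens R A). Qed.

Lemma PNF_compl (R : realType) (x : PN R) : PNF R x -> PNF R (~` x)%O.
Proof.
have [A ->] := clsP x; rewrite compl_cls => /PNF_cls/densFP/cvg_freq_setC cA.
by apply/PNF_cls/cvg_ex; exists (1 - dens R A).
Qed.

Lemma PNF_sup_nondecreasing (R : realType) (p : nat -> PN R) :
  nondecreasing_seq p -> (forall k, PNF R (p k)) ->
  exists2 s, PNF R s & supremums (range p) s.
Proof.
move=> pmono pF; have /choice[A pA] : forall k, exists A, p k = cls R A.
  by move=> k; exact: clsP.
have clsB n : cls R (\big[setU/set0]_(k < n.+1) A k) = p n.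
  elim: n => [|n IH]; first by rewrite big_ord_recr big_ord0/= set0U.
  by rewrite big_ord_recr/= -join_cls IH -pA; apply/join_r/pmono.
have FB n : densF R (\big[setU/set0]_(k < n) A k).
  apply/PNF_cls; case: n => [|n]; last by rewrite clsB.
  by rewrite big_ord0; apply/PNF_cls; case: (densN0 R).
have [S [L [_ cS supS]]] := supremum_of_partial_unions FB.
exists (cls R S); first by apply/PNF_cls/cvg_ex; exists L.
by rewrite (_ : p = fun k => cls R (A k)) //; apply/funext.
Qed.

Lemma compl_supremums d (T : ctbDistrLatticeType d) (p : nat -> T) (s : T) :
  supremums (range (fun k => ~` p k)%O) s -> infimums (range p) (~` s)%O.
Proof.
move=> [sub slub]; split=> [_ [k _ <-]|y ylb].
  by rewrite leCx; apply: sub; exists k.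
rewrite lexC; apply: slub => _ [k _ <-]; rewrite leC; apply: ylb.
by exists k.
Qed.

(** * Additivity *)

(** Each new set meets the union of the previous ones in a finite union of null
sets, so the inclusion-exclusion correction vanishes in the limit. *)
Lemma freq_disjoint_bigsetU (R : realType) (A : nat -> set posnat) (a : nat -> R) (n : nat) :
  (forall k, freq R (A k) @ \oo --> a k) ->
  (forall j k, j <> k -> densN R (A j `&` A k)) ->
  freq R (\big[setU/set0]_(k < n) A k) @ \oo --> series a n.
Proof.
move=> cA dA.
have dB m : forall k, (m <= k)%N -> densN R ((\big[setU/set0]_(j < m) A j) `&` A k).
  elim: m => [|m IH] k mk; first by rewrite big_ord0 set0I; exact: densN0.
  rewrite big_ord_recr/= setIUl; apply: densNU; first by apply: IH; exact: ltnW.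
  by apply: dA => mk'; rewrite mk' ltnn in mk.
elim: n => [|n IH].
  by rewrite big_ord0 seriesEnat/= big_geq//; apply/densNP; exact: densN0.
rewrite big_ord_recr/= seriesSr.
set B := \big[setU/set0]_(k < n) A k.
rewrite (_ : freq R _ = freq R B \+ (freq R (A n) \- freq R (B `&` A n))).
  rewrite -[a n]subr0; apply: cvgD => //; apply: cvgB => //.
  by apply/densNP; exact: dB.
apply/funext => N /=; rewrite [in RHS]setIC -freq_setDI -freqU_disjoint.
  by rewrite [in RHS]setUC setUDl setDv setD0 setUC.
by rewrite -subset0 => x [? []].
Qed.

Theorem corollary6p5 (R : realType) :
  boolean_monotone_class (PNF R) /\ nu_countably_additive R.
Proof.
split; first split; first exact: PNF_sup_nondecreasing.
- move=> p pmono pF.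
  have [s sF sup] : exists2 s, PNF R s & supremums (range (fun k => ~` p k)%O) s.
    apply: PNF_sup_nondecreasing => [m n mn|k]; first by rewrite leC pmono.
    exact: PNF_compl.
  by exists (~` s)%O; [exact: PNF_compl|exact: compl_supremums].
- move=> A AF disj.
  have cA k : freq R (A k) @ \oo --> nu (cls R (A k)).
    by have /PNF_cls AkF := AF k; rewrite nu_cls//; exact/densFP.
  have [S [L [cL cS sup]]] :=
    supremum_of_partial_unions (fun n => @freq_disjoint_bigsetU _ _ _ n cA disj).
  have SF : densF R S by apply/cvg_ex; exists L.
  exists (cls R S); split => //; first exact/PNF_cls.
  by rewrite nu_cls// /dens (cvg_lim _ cS).
Qed.
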